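(* Let $A\mid B$ be an algebra extension with centralizer $R=V_A(B)$ and $S=\operatorname{End}({}_BA_B)$, and suppose the natural module $A_B$ is finitely generated projective. Then $A\mid B$ is a left Galois extension if and only if the following three conditions hold: ${}_RS$ is finitely generated projective; the map $j: A\otimes_R S\to \operatorname{End}(A_B)$ given by $j(a\otimes\alpha)(x)=a\alpha(x)$ is an isomorphism; and $A^S=B$.
   Context: Algebras are unital, associative (not necessarily commutative) over a commutative ground ring $K$. An algebra extension $A\mid B$ is a unit-preserving algebra homomorphism $B\to A$; in ''$A^S=B$'' $B$ stands for its image in $A$. $V_A(B)$ is the centralizer of the image of $B$ in $A$. $S=\operatorname{End}({}_BA_B)$ is the algebra of $B$-$B$-bimodule endomorphisms of $A$, a left $R$-module by $(r\cdot\alpha)(x)=r\alpha(x)$. The invariant subalgebra is $A^S=\{x\in A:\alpha(x)=\alpha(1_A)x\ \ \forall\alpha\in S\}$. $X\oplus *\cong Y$ means $X$ is isomorphic to a direct summand of $Y$. $A\mid B$ is left D2 if $A\otimes_BA\oplus *\cong A^N$ as $B$-$A$-bimodules for some positive integer $N$. $A_B$ is balanced if, with $E=\operatorname{End}(A_B)$ acting on $A$ by evaluation, every $E$-linear endomorphism of ${}_EA$ is right multiplication by an element of (the image of) $B$. ''Left Galois extension'' (Galois with respect to a bialgebroid) is used here through its known characterization: $A\mid B$ is a left Galois extension if and only if it is left D2 and $A$ is balanced over $B$, i.e. $A_B$ is balanced. This may be taken as the definition. *)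

(* Defs.v *)
From HB Require Import structures.
From mathcomp Require Import all_boot all_algebra.
From mathcomp Require Import boolp functions.

Set Implicit Arguments.
Unset Strict Implicit.
Unset Printing Implicit Defensive.

Import GRing.Theory.
Local Open Scope ring_scope.
Local Open Scope quotient_scope.

(* Right modules over R are left modules over the converse ring R^c.          *)

(* algType is not used because it excludes the zero algebra. *)
Definition algebra_structure (K : comPzRingType) (A : pzRingType)
    (eta : {rmorphism K -> A}) : Prop :=
  forall k a, eta k * a = a * eta k.

Section Modules.
Variables (R : pzRingType).

Definition fin_gen (M : lmodType R) : Prop :=
  exists n (v : 'I_n -> M), forall x, exists c : 'I_n -> R,
    x = \sum_i c i *: v i.

Definition projective (P : lmodType R) : Prop :=
  forall (M N : lmodType R) (g : {linear M -> N}) (h : {linear P -> N}),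
    (forall y, exists x, g x = y) ->
    exists k : {linear P -> M}, forall x, g (k x) = h x.

Definition fg_projective (P : lmodType R) : Prop := fin_gen P /\ projective P.

End Modules.

(* M (x)_R N consists of the finite formal sums of symbols (m, n), modulo the *)
(* congruence generated by biadditivity and R-balancedness. No formal         *)
(* negatives are needed, since - (m (x) n) = (- m) (x) n. The universal       *)
(* property is given by tensor_liftD, tensor_liftE and tensor_lift_uniq.      *)

Section Tensor.
Variables (R : pzRingType) (M : lmodType R^c) (N : lmodType R).

Definition balanced (G : zmodType) (phi : M -> N -> G) : Prop :=
  [/\ forall m m' n, phi (m + m') n = phi m n + phi m' n,
      forall m n n', phi m (n + n') = phi m n + phi m n' &
      forall (r : R) m n, phi ((r : R^c) *: m) n = phi m (r *: n)].

Inductive tensor_rel : seq (M * N) -> seq (M * N) -> Prop :=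
| tensor_refl s : tensor_rel s s
| tensor_sym s t : tensor_rel s t -> tensor_rel t s
| tensor_trans s t u : tensor_rel s t -> tensor_rel t u -> tensor_rel s u
| tensor_cat s s' t t' :
    tensor_rel s t -> tensor_rel s' t' -> tensor_rel (s ++ s') (t ++ t')
| tensor_comm s t : tensor_rel (s ++ t) (t ++ s)
| tensor_0l n : tensor_rel [:: (0, n)] [::]
| tensor_Dl m m' n : tensor_rel [:: (m + m', n)] [:: (m, n); (m', n)]
| tensor_Dr m n n' : tensor_rel [:: (m, n + n')] [:: (m, n); (m, n')]
| tensor_bal (r : R) m n :
    tensor_rel [:: ((r : R^c) *: m, n)] [:: (m, r *: n)].

Definition tensor_eqb (s t : seq (M * N)) : bool := `[< tensor_rel s t >].

Lemma tensor_eqb_refl : reflexive tensor_eqb.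
Proof. by move=> s; apply/asboolP; exact: tensor_refl. Qed.

Lemma tensor_eqb_sym : symmetric tensor_eqb.
Proof. by move=> s t; apply/asboolP/asboolP; exact: tensor_sym. Qed.

Lemma tensor_eqb_trans : transitive tensor_eqb.
Proof.
by move=> t s u /asboolP st /asboolP tu; apply/asboolP; exact: tensor_trans tu.
Qed.

Canonical tensor_equiv :=
  EquivRel tensor_eqb tensor_eqb_refl tensor_eqb_sym tensor_eqb_trans.

Definition tensor : Type := {eq_quot tensor_equiv}.
HB.instance Definition _ : EqQuotient _ tensor_equiv tensor :=
  EqQuotient.on tensor.
HB.instance Definition _ := Choice.on tensor.

Let opps (s : seq (M * N)) := [seq (- p.1, p.2) | p <- s].

Definition tadd (x y : tensor) : tensor := \pi_tensor (repr x ++ repr y).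
Definition topp (x : tensor) : tensor := \pi_tensor (opps (repr x)).
Definition pure (m : M) (n : N) : tensor := \pi_tensor [:: (m, n)].

Lemma tensor_piP s t : \pi_tensor s = \pi_tensor t <-> tensor_rel s t.
Proof.
by split=> [/eqmodP/asboolP //|st]; apply/eqmodP; apply/asboolP.
Qed.

Lemma repr_rel s : tensor_rel (repr (\pi_tensor s)) s.
Proof. by apply/tensor_piP; rewrite reprK. Qed.

Lemma tadd_pi s t : tadd (\pi_tensor s) (\pi_tensor t) = \pi_tensor (s ++ t).
Proof. by apply/tensor_piP; apply: tensor_cat; exact: repr_rel. Qed.

Lemma opps_rel s : tensor_rel (opps s ++ s) [::].
Proof.
elim: s => [|[m n] s IHs] /=; first exact: tensor_refl.
have e : tensor_rel [:: (- m, n); (m, n)] [::].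
  apply: tensor_trans (tensor_0l n); apply: tensor_sym.
  by rewrite -{1}(addNr m); exact: tensor_Dl.
rewrite -cat1s -[(m, n) :: s]cat1s.
apply: (@tensor_trans _ (([:: (- m, n)] ++ [:: (m, n)]) ++ (opps s ++ s))).
  rewrite -!catA; apply: tensor_cat; first exact: tensor_refl.
  rewrite !catA; apply: tensor_cat; last exact: tensor_refl.
  exact: tensor_comm.
exact: (tensor_cat e IHs).
Qed.

Fact taddA : associative tadd.
Proof.
elim/quotW=> s; elim/quotW=> t; elim/quotW=> u.
by rewrite (tadd_pi t u) (tadd_pi s t) !tadd_pi catA.
Qed.

Fact taddC : commutative tadd.
Proof.
by move=> x y; apply/tensor_piP; exact: tensor_comm.
Qed.

Fact tadd0 : left_id (\pi_tensor [::]) tadd.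
Proof. by elim/quotW=> s; rewrite tadd_pi. Qed.

Fact taddN : left_inverse (\pi_tensor [::]) topp tadd.
Proof.
move=> x; rewrite -{2}[x]reprK tadd_pi; apply/tensor_piP; exact: opps_rel.
Qed.

HB.instance Definition _ :=
  GRing.isZmodule.Build tensor taddA taddC tadd0 taddN.

Lemma pi_cat s t :
  \pi_tensor (s ++ t) = \pi_tensor s + \pi_tensor t :> tensor.
Proof. by rewrite -tadd_pi. Qed.

Lemma pure_balanced : balanced pure.
Proof.
split=> *; rewrite /pure -?pi_cat; apply/tensor_piP.
- exact: tensor_Dl.
- exact: tensor_Dr.
- exact: tensor_bal.
Qed.

Lemma tensor_sum (x : tensor) : x = \sum_(p <- repr x) pure p.1 p.2.
Proof.
rewrite -{1}[x]reprK; elim: (repr x) => [|[m n] s IHs]; first by rewrite big_nil.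
by rewrite big_cons -IHs -cat1s pi_cat.
Qed.

(* The additive map M (x)_R N -> G induced by phi; only meaningful when phi   *)
(* is balanced.                                                               *)
Definition tensor_lift (G : zmodType) (phi : M -> N -> G) (x : tensor) : G :=
  \sum_(p <- repr x) phi p.1 p.2.

Section Lift.
Variables (G : zmodType) (phi : M -> N -> G) (bphi : balanced phi).

Lemma tensor_rel_sum s t : tensor_rel s t ->
  \sum_(p <- s) phi p.1 p.2 = \sum_(p <- t) phi p.1 p.2.
Proof.
case: bphi => Dl Dr bal.
elim=> //=.
- by move=> {}s {}t u _ -> _ ->.
- by move=> ? ? ? ? _ e1 _ e2; rewrite !big_cat /= e1 e2.
- by move=> {}s {}t; rewrite !big_cat /= addrC.
- move=> n; rewrite big_seq1 big_nil /=.
  by apply: (addrI (phi 0 n)); rewrite -Dl !addr0.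
- by move=> m m' n; rewrite !big_cons big_nil /= !addr0 Dl.
- by move=> m n n'; rewrite !big_cons big_nil /= !addr0 Dr.
- by move=> r m n; rewrite !big_seq1 /= bal.
Qed.

Lemma tensor_lift_pi s :
  tensor_lift phi (\pi_tensor s) = \sum_(p <- s) phi p.1 p.2.
Proof. by apply: tensor_rel_sum; exact: repr_rel. Qed.

Lemma tensor_liftD : {morph tensor_lift phi : x y / x + y}.
Proof.
elim/quotW=> s; elim/quotW=> t.
by rewrite -pi_cat !tensor_lift_pi big_cat.
Qed.

Lemma tensor_liftE m n : tensor_lift phi (pure m n) = phi m n.
Proof. by rewrite tensor_lift_pi big_seq1. Qed.

End Lift.

Lemma tensor_lift_uniq (G : zmodType) (g h : tensor -> G) :
  {morph g : x y / x + y} -> {morph h : x y / x + y} ->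
  (forall m n, g (pure m n) = h (pure m n)) -> g =1 h.
Proof.
move=> gD hD gh x; rewrite (tensor_sum x).
have f0 (k : tensor -> G) : {morph k : x y / x + y} -> k 0 = 0.
  by move=> kD; apply: (addrI (k 0)); rewrite -kD !addr0.
by rewrite (big_morph g gD (f0 _ gD)) (big_morph h hD (f0 _ hD)); apply: eq_bigr.
Qed.

End Tensor.

HB.mixin Record Lmodule_isBimodule (B A : pzRingType) M
    of GRing.Lmodule B M := {
  ract : M -> A -> M;
  ractDl : forall x y a, ract (x + y) a = ract x a + ract y a;
  ractDr : forall x a a', ract x (a + a') = ract x a + ract x a';
  ractM : forall x a a', ract x (a * a') = ract (ract x a) a';
  ract1 : forall x, ract x 1 = x;
  ractZ : forall (b : B) x a, ract (b *: x) a = b *: ract x a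
}.

#[short(type="bimodType")]
HB.structure Definition Bimodule (B A : pzRingType) :=
  {M of GRing.Lmodule B M & Lmodule_isBimodule B A M}.

Section Bimodules.
Variables (B A : pzRingType).

Section Prod.
Variables X Y : bimodType B A.

Definition prod_ract (p : X * Y) (a : A) : X * Y := (ract p.1 a, ract p.2 a).

Fact prod_ractDl p q a : prod_ract (p + q) a = prod_ract p a + prod_ract q a.
Proof. by congr pair; rewrite /= ractDl. Qed.
Fact prod_ractDr p a a' : prod_ract p (a + a') = prod_ract p a + prod_ract p a'.
Proof. by congr pair; rewrite /= ractDr. Qed.
Fact prod_ractM p a a' : prod_ract p (a * a') = prod_ract (prod_ract p a) a'.
Proof. by congr pair; rewrite /= ractM. Qed.
Fact prod_ract1 p : prod_ract p 1 = p.
Proof. by case: p => x y; rewrite /prod_ract /= !ract1. Qed.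
Fact prod_ractZ (b : B) p a : prod_ract (b *: p) a = b *: prod_ract p a.
Proof. by congr pair; rewrite /= ractZ. Qed.

HB.instance Definition _ := Lmodule_isBimodule.Build B A (X * Y)%type
  prod_ractDl prod_ractDr prod_ractM prod_ract1 prod_ractZ.
End Prod.

Section Power.
Variables (I : finType) (X : bimodType B A).

Definition ffun_ract (u : {ffun I -> X}) (a : A) : {ffun I -> X} :=
  [ffun i => ract (u i) a].

Fact ffun_ractDl u v a : ffun_ract (u + v) a = ffun_ract u a + ffun_ract v a.
Proof. by apply/ffunP=> i; rewrite !ffunE ractDl. Qed.
Fact ffun_ractDr u a a' : ffun_ract u (a + a') = ffun_ract u a + ffun_ract u a'.
Proof. by apply/ffunP=> i; rewrite !ffunE ractDr. Qed.
Fact ffun_ractM u a a' : ffun_ract u (a * a') = ffun_ract (ffun_ract u a) a'.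
Proof. by apply/ffunP=> i; rewrite !ffunE ractM. Qed.
Fact ffun_ract1 u : ffun_ract u 1 = u.
Proof. by apply/ffunP=> i; rewrite !ffunE ract1. Qed.
Fact ffun_ractZ (b : B) u a : ffun_ract (b *: u) a = b *: ffun_ract u a.
Proof. by apply/ffunP=> i; rewrite !ffunE ractZ. Qed.

HB.instance Definition _ := Lmodule_isBimodule.Build B A {ffun I -> X}
  ffun_ractDl ffun_ractDr ffun_ractM ffun_ract1 ffun_ractZ.
End Power.

Definition bimod_iso (X Y : bimodType B A) : Prop :=
  exists g : {linear X -> Y},
    (forall x (a : A), g (ract x a) = ract (g x) a) /\ bijective g.

(* X (+) * ~= Y *)
Definition direct_summand (X Y : bimodType B A) : Prop :=
  exists Z : bimodType B A, bimod_iso (X * Z)%type Y.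

End Bimodules.

Section Extension.
Variables (A B : pzRingType) (f : {rmorphism B -> A}).

(* lmod_of f is A as a left B-module and B-A-bimodule, rmod_of f is A as a    *)
(* right B-module; B acts through f, which need not be injective.             *)
Definition lmod_of of {rmorphism B -> A} : Type := A.
Local Notation lA := (lmod_of f).
HB.instance Definition _ := GRing.Zmodule.on lA.

Definition lmod_of_scale (b : B) (x : lA) : lA := f b * (x : A).

Fact lmod_of_scaleA a b x :
  lmod_of_scale a (lmod_of_scale b x) = lmod_of_scale (a * b) x.
Proof. by rewrite /lmod_of_scale rmorphM mulrA. Qed.
Fact lmod_of_scale1 : left_id 1 lmod_of_scale.
Proof. by move=> x; rewrite /lmod_of_scale rmorph1 mul1r. Qed.
Fact lmod_of_scaleDr : right_distributive lmod_of_scale +%R.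
Proof. by move=> b x y; exact: mulrDr. Qed.
Fact lmod_of_scaleDl x : {morph lmod_of_scale^~ x : a b / a + b}.
Proof. by move=> a b; rewrite /lmod_of_scale rmorphD; exact: mulrDl. Qed.

HB.instance Definition _ := GRing.Zmodule_isLmodule.Build B lA
  lmod_of_scaleA lmod_of_scale1 lmod_of_scaleDr lmod_of_scaleDl.

Definition lmod_of_ract (x : lA) (a : A) : lA := (x : A) * a.

HB.instance Definition _ := Lmodule_isBimodule.Build B A lA
  (ract := lmod_of_ract)
  (fun x y a => mulrDl x y a) (fun x a a' => mulrDr x a a')
  (fun x a a' => mulrA x a a') (fun x => mulr1 x)
  (fun b x a => esym (mulrA (f b) x a)).

Definition rmod_of of {rmorphism B -> A} : Type := A.
Local Notation rA := (rmod_of f).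
HB.instance Definition _ := GRing.Zmodule.on rA.

Definition rmod_of_scale (b : B^c) (x : rA) : rA := (x : A) * f b.

Fact rmod_of_scaleA a b x :
  rmod_of_scale a (rmod_of_scale b x) = rmod_of_scale (a * b) x.
Proof. by rewrite /rmod_of_scale -mulrA -rmorphM. Qed.
Fact rmod_of_scale1 : left_id 1 rmod_of_scale.
Proof. by move=> x; rewrite /rmod_of_scale rmorph1 mulr1. Qed.
Fact rmod_of_scaleDr : right_distributive rmod_of_scale +%R.
Proof. by move=> b x y; exact: mulrDl. Qed.
Fact rmod_of_scaleDl x : {morph rmod_of_scale^~ x : a b / a + b}.
Proof. by move=> a b; rewrite /rmod_of_scale rmorphD; exact: mulrDr. Qed.

HB.instance Definition _ := GRing.Zmodule_isLmodule.Build B^c rA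
  rmod_of_scaleA rmod_of_scale1 rmod_of_scaleDr rmod_of_scaleDl.

(* A (x)_B A as a B-A-bimodule, b (x (x) y) a = (b x) (x) (y a) *)
Definition tsquare of {rmorphism B -> A} : Type := tensor rA lA.
Local Notation tA := (tsquare f).
HB.instance Definition _ := GRing.Zmodule.on tA.

Definition tsquare_scale (b : B) (t : tA) : tA :=
  tensor_lift (fun (x : rA) (y : lA) => pure (f b * (x : A) : rA) y) t.

Definition tsquare_ract (t : tA) (a : A) : tA :=
  tensor_lift (fun (x : rA) (y : lA) => pure x ((y : A) * a : lA)) t.

Lemma tsquare_scale_balanced (b : B) :
  balanced (fun (x : rA) (y : lA) => pure (f b * (x : A) : rA) y).
Proof.
have [Dl Dr bal] := pure_balanced rA lA; split=> [x x' y|x y y'|r x y].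
- by rewrite -Dl; congr pure; exact: mulrDr.
- by rewrite -Dr.
- by rewrite -bal; congr pure; exact: mulrA.
Qed.

Lemma tsquare_ract_balanced (a : A) :
  balanced (fun (x : rA) (y : lA) => pure x ((y : A) * a : lA)).
Proof.
have [Dl Dr bal] := pure_balanced rA lA; split=> [x x' y|x y y'|r x y].
- by rewrite -Dl.
- by rewrite -Dr; congr pure; exact: mulrDl.
- by rewrite bal; congr pure; rewrite /GRing.scale /= /lmod_of_scale mulrA.
Qed.

Lemma tsquare_scaleE b (x : rA) (y : lA) :
  tsquare_scale b (pure x y) = pure (f b * (x : A) : rA) y.
Proof. exact: (tensor_liftE (tsquare_scale_balanced b)). Qed.

Lemma tsquare_ractE (x : rA) (y : lA) a :
  tsquare_ract (pure x y) a = pure x ((y : A) * a : lA).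
Proof. exact: (tensor_liftE (tsquare_ract_balanced a)). Qed.

Fact tsquare_scaleDr : right_distributive tsquare_scale +%R.
Proof. by move=> b; exact: (tensor_liftD (tsquare_scale_balanced b)). Qed.

Fact tsquare_ractDl t u a :
  tsquare_ract (t + u) a = tsquare_ract t a + tsquare_ract u a.
Proof. exact: (tensor_liftD (tsquare_ract_balanced a)). Qed.

Fact tsquare_scaleA a b t :
  tsquare_scale a (tsquare_scale b t) = tsquare_scale (a * b) t.
Proof.
apply: (tensor_lift_uniq (g := fun t => tsquare_scale a (tsquare_scale b t))
  (h := tsquare_scale (a * b)) _ _ _ t).
- by move=> x y; rewrite !tsquare_scaleDr.
- by move=> x y; rewrite tsquare_scaleDr.
- by move=> x y; rewrite !tsquare_scaleE rmorphM mulrA.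
Qed.
Fact tsquare_scale1 : left_id 1 tsquare_scale.
Proof.
apply: (tensor_lift_uniq (g := tsquare_scale 1) (h := id)) => //.
- by move=> x y; rewrite tsquare_scaleDr.
- by move=> x y; rewrite tsquare_scaleE rmorph1 mul1r.
Qed.
Fact tsquare_scaleDl t : {morph tsquare_scale^~ t : a b / a + b}.
Proof.
move=> a b; apply: (tensor_lift_uniq (g := tsquare_scale (a + b))
  (h := fun t => tsquare_scale a t + tsquare_scale b t) _ _ _ t).
- by move=> x y; rewrite tsquare_scaleDr.
- by move=> x y; rewrite !tsquare_scaleDr addrACA.
- have [Dl _ _] := pure_balanced rA lA.
  by move=> x y; rewrite !tsquare_scaleE -Dl rmorphD mulrDl.
Qed.

HB.instance Definition _ := GRing.Zmodule_isLmodule.Build B tA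
  tsquare_scaleA tsquare_scale1 tsquare_scaleDr tsquare_scaleDl.

Fact tsquare_ractDr t a a' :
  tsquare_ract t (a + a') = tsquare_ract t a + tsquare_ract t a'.
Proof.
apply: (tensor_lift_uniq (g := tsquare_ract^~ (a + a'))
  (h := fun t => tsquare_ract t a + tsquare_ract t a') _ _ _ t).
- by move=> x y; rewrite tsquare_ractDl.
- by move=> x y; rewrite !tsquare_ractDl addrACA.
- have [_ Dr _] := pure_balanced rA lA.
  by move=> x y; rewrite !tsquare_ractE -Dr mulrDr.
Qed.
Fact tsquare_ractM t a a' :
  tsquare_ract t (a * a') = tsquare_ract (tsquare_ract t a) a'.
Proof.
apply: (tensor_lift_uniq (g := tsquare_ract^~ (a * a'))
  (h := fun t => tsquare_ract (tsquare_ract t a) a') _ _ _ t).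
- by move=> x y; rewrite tsquare_ractDl.
- by move=> x y; rewrite !tsquare_ractDl.
- by move=> x y; rewrite !tsquare_ractE mulrA.
Qed.
Fact tsquare_ract1 t : tsquare_ract t 1 = t.
Proof.
apply: (tensor_lift_uniq (g := tsquare_ract^~ 1) (h := id) _ _ _ t) => //.
- by move=> x y; rewrite tsquare_ractDl.
- by move=> x y; rewrite tsquare_ractE mulr1.
Qed.
Fact tsquare_ractZ (b : B) t a :
  tsquare_ract (b *: t) a = b *: tsquare_ract t a.
Proof.
apply: (tensor_lift_uniq (g := fun t => tsquare_ract (tsquare_scale b t) a)
  (h := fun t => tsquare_scale b (tsquare_ract t a)) _ _ _ t).
- by move=> x y; rewrite tsquare_scaleDr tsquare_ractDl.
- by move=> x y; rewrite tsquare_ractDl tsquare_scaleDr.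
- by move=> x y; rewrite tsquare_ractE !tsquare_scaleE tsquare_ractE.
Qed.

HB.instance Definition _ := Lmodule_isBimodule.Build B A tA
  tsquare_ractDl tsquare_ractDr tsquare_ractM tsquare_ract1 tsquare_ractZ.

Definition left_D2 : Prop :=
  exists N : nat, (0 < N)%N /\ direct_summand tA {ffun 'I_N -> lA}.

(* The endomorphism ring E of A_B is the type {linear rA -> rA}. *)
Definition balanced_module : Prop :=
  forall phi : {additive A -> A},
    (forall (e : {linear rA -> rA}) (x : A), phi (e x) = e (phi x)) ->
    exists b : B, forall x, phi x = x * f b.

Definition left_Galois : Prop := left_D2 /\ balanced_module.

Definition centralizer_pred : {pred A} :=
  fun x => `[< forall b, f b * x = x * f b >].

Fact centralizer_subring : subring_closed centralizer_pred.
Proof.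
split.
- by apply/asboolP => b; rewrite mulr1 mul1r.
- move=> x y /asboolP xP /asboolP yP; apply/asboolP => b.
  by rewrite mulrBr mulrBl xP yP.
- move=> x y /asboolP xP /asboolP yP; apply/asboolP => b.
  by rewrite mulrA xP -mulrA yP mulrA.
Qed.

Record centralizer :=
  Centralizer { cval :> A; _ : cval \in centralizer_pred }.
HB.instance Definition _ := [isSub for cval].
HB.instance Definition _ := [Choice of centralizer by <:].
HB.instance Definition _ := GRing.SubChoice_isSubPzRing.Build A
  centralizer_pred centralizer centralizer_subring.
HB.instance Definition _ := GRing.RMorphism.copy cval (val : centralizer -> A).

Local Notation R := centralizer.

Lemma centralizerP (r : R) b : f b * cval r = cval r * f b.
Proof. by case: r => r /= /asboolP. Qed.

Definition bimod_end_pred : {pred A -> A} := fun alpha =>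
  `[< linear (alpha : lA -> lA) /\ linear (alpha : rA -> rA) >].

Record bimod_end :=
  BimodEnd { efun :> A -> A; _ : efun \in bimod_end_pred }.
HB.instance Definition _ := [isSub for efun].
HB.instance Definition _ := [Choice of bimod_end by <:].

Local Notation S := bimod_end.

Lemma bimod_endP (alpha : A -> A) : reflect
  [/\ {morph alpha : x y / x + y}, forall b x, alpha (f b * x) = f b * alpha x
    & forall b x, alpha (x * f b) = alpha x * f b]
  (alpha \in bimod_end_pred).
Proof.
apply: (iffP (asboolP _)) => [[ll lr]|[D l r]].
  have D : {morph alpha : x y / x + y}.
    by move=> x y; have := ll 1 x y; rewrite !scale1r.
  have a0 : alpha 0 = 0 by apply: (addrI (alpha 0)); rewrite -D !addr0.
  split=> // b x.
    by have := ll b x 0; rewrite !addr0 => ->; rewrite a0 addr0.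
  by have := lr (b : B^c) x 0; rewrite !addr0 => ->; rewrite a0 addr0.
split=> b x y; rewrite [LHS]D; congr (_ + _); first exact: l.
exact: r.
Qed.

Fact bimod_end_zmod : zmod_closed bimod_end_pred.
Proof.
split.
  apply/bimod_endP; split=> [x y|b x|b x].
  - exact: (esym (addr0 (0 : A))).
  - exact: (esym (mulr0 _)).
  - exact: (esym (mul0r _)).
move=> u v /bimod_endP [Du lu ru] /bimod_endP [Dv lv rv]; apply/bimod_endP.
have E x : (u - v) x = u x - v x by [].
split=> [x y|b x|b x]; rewrite !E.
- by rewrite Du Dv opprD addrACA.
- by rewrite lu lv mulrBr.
- by rewrite ru rv mulrBl.
Qed.

HB.instance Definition _ := GRing.isZmodClosed.Build (A -> A) bimod_end_pred
  bimod_end_zmod.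
HB.instance Definition _ := [SubChoice_isSubZmodule of bimod_end by <:].

Fact bimod_end_scale_subproof (r : R) (alpha : S) :
  (fun x => cval r * alpha x) \in bimod_end_pred.
Proof.
case: alpha => alpha /= /bimod_endP [D l h]; apply/bimod_endP.
split=> [x y|b x|b x]; first by rewrite D mulrDr.
  by rewrite l !mulrA centralizerP.
by rewrite h mulrA.
Qed.

Definition bimod_end_scale (r : R) (alpha : S) : S :=
  BimodEnd (bimod_end_scale_subproof r alpha).

Fact bimod_end_scaleA r s alpha :
  bimod_end_scale r (bimod_end_scale s alpha) = bimod_end_scale (r * s) alpha.
Proof. by apply/val_inj/funext => x; exact: mulrA. Qed.
Fact bimod_end_scale1 : left_id 1 bimod_end_scale.
Proof. by move=> alpha; apply/val_inj/funext => x; exact: mul1r. Qed.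
Fact bimod_end_scaleDr : right_distributive bimod_end_scale +%R.
Proof. by move=> r alpha beta; apply/val_inj/funext => x; exact: mulrDr. Qed.
Fact bimod_end_scaleDl alpha : {morph bimod_end_scale^~ alpha : r s / r + s}.
Proof. by move=> r s; apply/val_inj/funext => x; exact: mulrDl. Qed.

HB.instance Definition _ := GRing.Zmodule_isLmodule.Build R S
  bimod_end_scaleA bimod_end_scale1 bimod_end_scaleDr bimod_end_scaleDl.

End Extension.

Section Galois.
Variables (A B : pzRingType) (f : {rmorphism B -> A}).
Local Notation R := (centralizer f).
Local Notation S := (bimod_end f).

Local Notation A_R := (rmod_of (@cval A B f : {rmorphism R -> A})).
Local Notation A_B := (rmod_of f).

Definition jfun (t : tensor A_R S) : A_B -> A_B :=
  tensor_lift (fun (a : A_R) (alpha : S) => fun x : A => (a : A) * alpha x) t.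

Lemma jfun_balanced :
  balanced (fun (a : A_R) (alpha : S) => fun x : A => (a : A) * alpha x).
Proof.
split=> *; apply/funext => x.
- exact: mulrDl.
- exact: mulrDr.
- by rewrite mulrA.
Qed.

Lemma jfunE (a : A) (alpha : S) (x : A) :
  jfun (pure (a : A_R) alpha) x = a * alpha x.
Proof. by rewrite /jfun (tensor_liftE jfun_balanced). Qed.

Lemma jfunD : {morph jfun : t u / t + u}.
Proof. exact: (tensor_liftD jfun_balanced). Qed.

Fact jfun_linear t : linear (jfun t).
Proof.
move=> b x y; rewrite /jfun /tensor_lift !fct_sumE scaler_sumr -big_split /=.
apply: eq_bigr => -[a [alpha /= /bimod_endP [D l r]]] _ /=.
by rewrite [X in _ * X]D mulrDr r mulrA.
Qed.

HB.instance Definition _ t :=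
  GRing.isLinear.Build B^c A_B A_B _ (jfun t) (jfun_linear t).

(* jfunE and jfunD: j is the additive map with j (a (x) alpha) x = a alpha(x). *)
Definition j (t : tensor A_R S) : {linear A_B -> A_B} := jfun t.

Definition invariant (x : A) : Prop :=
  forall alpha : S, alpha x = alpha 1 * x.

Definition invariants_eq_base : Prop :=
  forall x : A, invariant x <-> exists b : B, x = f b.

End Galois.

(* Main.v *)
Require Import Defs.
From HB Require Import structures.
From mathcomp Require Import all_boot all_algebra.
From mathcomp Require Import boolp functions.
Import GRing.Theory.
Local Open Scope ring_scope.

Set Implicit Arguments.
Unset Strict Implicit.

(** Write E for the endomorphism ring of A_B. Everything goes through a left
D2 quasi-basis: elements beta_i of S and B-central elements t_i of A (x)_B A
with x (x) 1 = sum_i t_i beta_i(x) for all x in A. Bimodule maps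
A (x)_B A -> A correspond to S by evaluation at x (x) 1, and bimodule maps
A -> A (x)_B A correspond to B-central tensors by evaluation at 1, so that a
quasi-basis is the same thing as a factorization of the identity of
A (x)_B A through a power of A, i.e. as the left D2 property
([left_D2_quasi_basis], [quasi_basis_left_D2]).

From a quasi-basis to the three conditions. An endomorphism e of A_B extends
to the map x (x) y |-> e(x) y on A (x)_B A, called contraction along e below.
Contracting the quasi-basis equation along e gives
e = sum_i (e contracted with t_i) beta_i. For e in S the coefficients lie in
R, because t_i is B-central, so the beta_i have dual coordinates in R and
S is finitely generated projective ([quasi_basis_dual_basis]). For arbitrary e
the same formula is an inverse of j ([quasi_basis_j_bijective]). Finally, if x
is S-invariant, then right multiplication by x commutes with all a alpha(-),
hence with all of E since j is onto; as A_B is balanced, x comes from B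
([balanced_invariants_eq_base]).

From the three conditions to a quasi-basis. Balancedness is immediate: an
E-linear endomorphism of A is right multiplication by its value at 1, which
is S-invariant ([invariants_eq_base_balanced]). For the quasi-basis take dual
bases beta_i, rho_i of S over R and a_k, psi_k of A_B. Since j is bijective,
a (x) alpha |-> a rho_i(alpha) provides left A-linear coordinates pi_i on E
with e = sum_i pi_i(e) beta_i, and they turn precomposition by left
multiplication with b into right multiplication by b. Then
t_i = sum_k a_k (x) pi_i(f o psi_k) is a quasi-basis
([dual_bases_quasi_basis]). *)

(** * Linear maps *)

Section LinearMaps.

Lemma morph_add_sum (U V : zmodType) (g : U -> V) :
  {morph g : x y / x + y} ->
  forall (I : Type) (r : seq I) (F : I -> U),
    g (\sum_(i <- r) F i) = \sum_(i <- r) g (F i).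
Proof.
move=> gD I r F; apply: (big_morph g gD).
by apply: (addrI (g 0)); rewrite -gD !addr0.
Qed.

Definition linear_pack (R : pzRingType) (U V : lmodType R) (g : U -> V)
    (gL : linear g) : {linear U -> V} :=
  HB.pack g (GRing.isLinear.Build R U V *:%R g gL).

Definition scalar_pack (R : pzRingType) (U : lmodType R) (g : U -> R)
    (gL : scalar g) : {scalar U} :=
  HB.pack g (GRing.isLinear.Build R U R *%R g gL).

Lemma linear_ext (R : pzRingType) (U V : lmodType R) (g h : {linear U -> V}) :
  g =1 h -> g = h.
Proof.
case: g => g [[g1] [g2]]; case: h => h [[h1] [h2]] /= /funext E.
case: _ / E in h1 h2 *.
by rewrite (Prop_irrelevance g1 h1) (Prop_irrelevance g2 h2).
Qed.

Lemma left_mul_linear (A C : pzRingType) (g : {rmorphism C -> A}) (c : A) :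
  linear (fun x : rmod_of g => (c * (x : A) : rmod_of g)).
Proof. by move=> r x y; rewrite [LHS]mulrDr; congr (_ + _); exact: mulrA. Qed.

End LinearMaps.

(** * Dual bases of finitely generated projective modules *)

Section DualBasis.
Variables (R : pzRingType) (M : lmodType R).

Definition dual_basis n (v : 'I_n -> M) (rho : 'I_n -> {scalar M}) : Prop :=
  forall x, x = \sum_i rho i x *: v i.

(** Splitting the surjection from a free module onto M gives the coordinates.
A zero generator is added so that there is at least one: the left D2 property
asks for a positive exponent. *)
Lemma fg_projective_dual_basis :
  fg_projective M ->
  exists n (v : 'I_n.+1 -> M) (rho : 'I_n.+1 -> {scalar M}), dual_basis v rho.
Proof.
case=> -[n [w gen_w]] projM.
pose v (i : 'I_n.+1) := if unlift ord0 i is Some i' then w i' else 0.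
pose g (u : {ffun 'I_n.+1 -> R^o}) : M := \sum_i (u i : R) *: v i.
have gL : linear g.
  move=> r u u'; rewrite /g scaler_sumr -big_split /=; apply: eq_bigr => i _.
  by rewrite !ffunE scalerDl scalerA.
have idL : linear (idfun : M -> M) by [].
have [|s sE] := projM _ _ (linear_pack gL) (linear_pack idL).
  move=> y; have [c ->] := gen_w y.
  exists [ffun i => if unlift ord0 i is Some i' then c i' else 0].
  rewrite /= /g big_ord_recl ffunE unlift_none scale0r add0r.
  by apply: eq_bigr => i _; rewrite ffunE /v liftK.
have rhoL (i : 'I_n.+1) : scalar (fun x => s x i : R).
  by move=> r x y; rewrite linearP !ffunE.
exists n, v, (fun i => scalar_pack (rhoL i)).
by move=> x; rewrite -[LHS](sE x).
Qed.

Lemma dual_basis_fg_projective n (v : 'I_n -> M) (rho : 'I_n -> {scalar M}) :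
  dual_basis v rho -> fg_projective M.
Proof.
move=> vrho; split; first by exists n, v => x; exists (rho^~ x); exact: vrho.
move=> U V g h surj_g.
have [y yE] := choice (fun i => surj_g (h (v i))).
have kL : linear (fun x => \sum_i rho i x *: y i).
  move=> r x x'; rewrite scaler_sumr -big_split /=; apply: eq_bigr => i _.
  by rewrite linearP scalerDl scalerA.
exists (linear_pack kL) => x /=.
rewrite {2}[x]vrho !linear_sum; apply: eq_bigr => i _.
by rewrite !linearZ /= yE.
Qed.

End DualBasis.

(** * Tensor products of modules *)

Section TensorMap.
Variables (R : pzRingType) (M : lmodType R^c) (N : lmodType R).

Lemma pure_sumr (m : M) n (y : 'I_n -> N) :
  pure m (\sum_i y i) = \sum_i pure m (y i).
Proof.
by have [_ Dr _] := pure_balanced M N; exact: morph_add_sum (Dr m) _ _ _.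
Qed.

Lemma pure_suml n (x : 'I_n -> M) (y : N) :
  pure (\sum_i x i) y = \sum_i pure (x i) y.
Proof.
have [Dl _ _] := pure_balanced M N.
exact: (morph_add_sum (g := fun m => pure m y) (fun m m' => Dl m m' y)).
Qed.

Definition tensor_mapl (u : {linear M -> M}) (t : tensor M N) : tensor M N :=
  tensor_lift (fun m n => pure (u m) n) t.

Lemma tensor_mapl_balanced (u : {linear M -> M}) :
  balanced (fun (m : M) (n : N) => pure (u m) n).
Proof.
have [Dl Dr bal] := pure_balanced M N; split=> *.
- by rewrite linearD Dl.
- by rewrite Dr.
- by rewrite linearZ bal.
Qed.

Lemma tensor_maplE u m n : tensor_mapl u (pure m n) = pure (u m) n.
Proof. exact: (tensor_liftE (tensor_mapl_balanced u)). Qed.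

Lemma tensor_maplD u : {morph tensor_mapl u : x y / x + y}.
Proof. exact: (tensor_liftD (tensor_mapl_balanced u)). Qed.

End TensorMap.

(** * Split surjections of bimodules *)

Section KernelBimodule.
Variables (B A : pzRingType) (X Y : bimodType B A) (p : {linear Y -> X}).
Hypothesis p_ract : forall y (a : A), p (ract y a) = ract (p y) a.

Definition ker_pred : {pred Y} := fun y => p y == 0.

Fact ker_submod : submod_closed ker_pred.
Proof.
split=> [|b y y' /eqP py /eqP py']; rewrite /in_mem /= /ker_pred.
  by rewrite linear0.
by rewrite linearP py py' scaler0 addr0.
Qed.
HB.instance Definition _ := GRing.isSubmodClosed.Build B Y ker_pred ker_submod.

Record bimod_ker := BimodKer { kval :> Y; _ : kval \in ker_pred }.
HB.instance Definition _ := [isSub for kval].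
HB.instance Definition _ := [Choice of bimod_ker by <:].
HB.instance Definition _ := [SubChoice_isSubLmodule of bimod_ker by <:].

Lemma ract0 (V : bimodType B A) (a : A) : ract (0 : V) a = 0.
Proof. by apply: (addrI (ract 0 a)); rewrite -ractDl !addr0. Qed.

Fact ker_ract_subproof (z : bimod_ker) (a : A) : ract (kval z) a \in ker_pred.
Proof.
by case: z => y /= /eqP py; rewrite /in_mem /= /ker_pred p_ract py ract0.
Qed.

Definition ker_ract (z : bimod_ker) (a : A) : bimod_ker :=
  BimodKer (ker_ract_subproof z a).

Fact ker_ractDl z z' a : ker_ract (z + z') a = ker_ract z a + ker_ract z' a.
Proof. by apply: val_inj; exact: ractDl. Qed.
Fact ker_ractDr z a a' : ker_ract z (a + a') = ker_ract z a + ker_ract z a'.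
Proof. by apply: val_inj; exact: ractDr. Qed.
Fact ker_ractM z a a' : ker_ract z (a * a') = ker_ract (ker_ract z a) a'.
Proof. by apply: val_inj; exact: ractM. Qed.
Fact ker_ract1 z : ker_ract z 1 = z.
Proof. by apply: val_inj; exact: ract1. Qed.
Fact ker_ractZ (b : B) z a : ker_ract (b *: z) a = b *: ker_ract z a.
Proof. by apply: val_inj; exact: ractZ. Qed.

Definition ker_bimod : bimodType B A :=
  HB.pack bimod_ker (Lmodule_isBimodule.Build B A bimod_ker
    ker_ractDl ker_ractDr ker_ractM ker_ract1 ker_ractZ).

(** The complement of X in Y is the kernel of the retraction p. *)
Lemma split_epi_direct_summand (s : {linear X -> Y}) :
  (forall x (a : A), s (ract x a) = ract (s x) a) -> cancel s p ->
  direct_summand X Y.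
Proof.
move=> s_ract sK; exists ker_bimod.
pose g (q : X * ker_bimod) : Y := s q.1 + kval q.2.
have gL : linear g.
  by move=> b q q'; rewrite /g /= linearP scalerDr addrACA.
have kerP y : y - s (p y) \in ker_pred.
  by rewrite /in_mem /= /ker_pred linearB sK subrr.
exists (linear_pack gL); split=> [q a|].
  by rewrite /= /g ractDl s_ract.
exists (fun y => (p y, BimodKer (kerP y))) => [[x [z pz]]|y] /=.
  have pg : p (s x + z) = x by rewrite linearD sK (eqP pz) addr0.
  rewrite /g /=; congr pair => //; apply: val_inj.
  by rewrite /= pg addrC addKr.
by rewrite /g /= addrC subrK.
Qed.

End KernelBimodule.

(** * Quasi-bases and the left D2 property *)

Section QuasiBasis.
Variables (A B : pzRingType) (f : {rmorphism B -> A}).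
Local Notation R := (centralizer f).
Local Notation S := (bimod_end f).
Local Notation A_B := (rmod_of f).
Local Notation BA := (lmod_of f).
Local Notation AA := (tsquare f f).
Local Notation E := {linear A_B -> A_B}.
Local Notation A_R := (rmod_of (@cval A B f : {rmorphism R -> A})).

Lemma bimod_end_add (alpha : S) : {morph alpha : x y / x + y}.
Proof. by case: alpha => alpha /= /bimod_endP []. Qed.
Lemma bimod_end_left (alpha : S) b x : alpha (f b * x) = f b * alpha x.
Proof. by case: alpha => alpha /= /bimod_endP []. Qed.
Lemma bimod_end_right (alpha : S) b x : alpha (x * f b) = alpha x * f b.
Proof. by case: alpha => alpha /= /bimod_endP []. Qed.

Lemma bimod_end_linear (alpha : S) : linear (alpha : A_B -> A_B).
Proof.
by move=> b x y; rewrite bimod_end_add [X in X + _]bimod_end_right.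
Qed.

Definition endo_of_bimod_end (alpha : S) : E :=
  linear_pack (bimod_end_linear alpha).

Lemma endo_right (e : E) (x : A) b : e (x * f b) = (e x : A) * f b.
Proof. exact: (linearZ_LR e (b : B^c) (x : A_B)). Qed.

Lemma bimod_end_sum n (r : 'I_n -> R) (beta : 'I_n -> S) (x : A) :
  (\sum_i r i *: beta i : S) x = \sum_i cval (r i) * beta i x.
Proof.
exact: (morph_add_sum (g := fun alpha : S => alpha x) (fun _ _ => erefl)).
Qed.

Definition contract (e : E) (t : AA) : A :=
  tensor_lift (fun (x : A_B) (y : BA) => (e x : A) * (y : A)) t.

Lemma contract_balanced (e : E) :
  balanced (fun (x : A_B) (y : BA) => (e x : A) * (y : A)).
Proof.
split=> [x x' y|x y y'|b x y].
- by rewrite linearD; exact: mulrDl.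
- exact: mulrDr.
- by rewrite [e _]endo_right; exact: (esym (mulrA _ _ _)).
Qed.

Lemma contractE e (x : A_B) (y : BA) :
  contract e (pure x y) = (e x : A) * (y : A).
Proof. exact: (tensor_liftE (contract_balanced e)). Qed.

Lemma contractD e : {morph contract e : t u / t + u}.
Proof. exact: (tensor_liftD (contract_balanced e)). Qed.

Lemma contract_ract e t (a : A) : contract e (ract t a) = contract e t * a.
Proof.
apply: (tensor_lift_uniq (g := fun t : AA => contract e (ract t a))
  (h := fun t => contract e t * a) _ _ _ t) => [u v|u v|x y].
- by rewrite ractDl contractD.
- by rewrite contractD mulrDl.
- by rewrite [ract _ _]tsquare_ractE !contractE mulrA.
Qed.

Lemma contract_bimod_end_scale (alpha : S) b (t : AA) :
  contract (endo_of_bimod_end alpha) (b *: t) =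
  f b * contract (endo_of_bimod_end alpha) t.
Proof.
apply: (tensor_lift_uniq
  (g := fun t : AA => contract (endo_of_bimod_end alpha) (b *: t))
  (h := fun t => f b * contract (endo_of_bimod_end alpha) t) _ _ _ t)
  => [u v|u v|x y].
- by rewrite scalerDr contractD.
- by rewrite contractD mulrDr.
- by rewrite [_ *: _]tsquare_scaleE !contractE /= bimod_end_left mulrA.
Qed.

Lemma contract_add (e e' e'' : E) t :
  (forall x, e'' x = (e x + e' x : A)) ->
  contract e'' t = contract e t + contract e' t.
Proof.
move=> e''E; rewrite /contract /tensor_lift -big_split /=.
by apply: eq_bigr => p _; rewrite e''E mulrDl.
Qed.

Lemma contract_scale (a : A) (e e' : E) t :
  (forall x, e' x = a * (e x : A)) -> contract e' t = a * contract e t.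
Proof.
move=> e'E; rewrite /contract /tensor_lift mulr_sumr.
by apply: eq_bigr => p _; rewrite e'E mulrA.
Qed.

Definition quasi_basis n (beta : 'I_n -> S) (t : 'I_n -> AA) : Prop :=
  (forall i b, b *: t i = ract (t i) (f b)) /\
  forall x : A, pure (x : A_B) (1 : BA) = \sum_i ract (t i) (beta i x).

Lemma quasi_basis_pure n (beta : 'I_n -> S) (t : 'I_n -> AA) :
  quasi_basis beta t -> forall (x : A_B) (y : BA),
  pure x y = \sum_i ract (t i) (beta i x * (y : A)).
Proof.
case=> _ qb x y.
have -> : pure x y = ract (pure x (1 : BA) : AA) (y : A).
  by rewrite [RHS]tsquare_ractE mul1r.
rewrite qb (morph_add_sum (fun t u => ractDl t u (y : A))).
by apply: eq_bigr => i _; rewrite ractM.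
Qed.

(** In terms of a splitting s : A (x)_B A -> A^n with retraction p, beta_i(x)
is the i-th coordinate of s(x (x) 1) and t_i is the image under p of the i-th
unit vector, which is B-central because that vector is. *)
Lemma left_D2_quasi_basis :
  left_D2 f -> exists n (beta : 'I_n -> S) (t : 'I_n -> AA), quasi_basis beta t.
Proof.
case=> n [_ [Z [g [g_ract [g' gK g'K]]]]].
pose s (x : AA) := g (x, 0).
have sD : {morph s : x y / x + y}.
  by move=> x y; rewrite /s -linearD; congr (g (_, _)); rewrite addr0.
have sZ b x : s (b *: x) = b *: s x.
  by rewrite /s -linearZ; congr (g (_, _)); rewrite scaler0.
have s_ract x (a : A) : s (ract x a) = ract (s x) a.
  by rewrite /s -g_ract; congr (g (_, _)); rewrite ract0.
have g'D : {morph g' : u v / u + v}.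
  by move=> u v; apply: (can_inj gK); rewrite linearD !g'K.
have g'Z b u : g' (b *: u) = b *: g' u.
  by apply: (can_inj gK); rewrite linearZ !g'K.
have g'_ract u (a : A) : g' (ract u a) = ract (g' u) a.
  by apply: (can_inj gK); rewrite g_ract !g'K.
pose unit_vec (i : 'I_n) : {ffun 'I_n -> BA} :=
  [ffun k => if k == i then (1 : A) else 0].
have [Dl Dr bal] := pure_balanced A_B BA.
have betaP i : (fun x : A => s (pure (x : A_B) (1 : BA)) i : A)
    \in bimod_end_pred f.
  apply/bimod_endP; split=> [x y|b x|b x].
  - by rewrite Dl sD ffunE.
  - have -> : pure (f b * x : A_B) (1 : BA) =
        b *: (pure (x : A_B) (1 : BA) : AA).
      by rewrite [RHS]tsquare_scaleE.
    by rewrite sZ ffunE.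
  - have -> : pure (x * f b : A_B) (1 : BA) =
        ract (pure (x : A_B) (1 : BA) : AA) (f b).
      rewrite [RHS]tsquare_ractE mul1r.
      have := bal b x (1 : BA); rewrite [_ *: (1 : BA)]mulr1; exact.
    by rewrite s_ract ffunE.
exists n, (fun i => BimodEnd (betaP i)), (fun i => (g' (unit_vec i)).1).
split=> [i b|x /=].
  transitivity (g' (b *: unit_vec i)).1; first by rewrite g'Z.
  transitivity (g' (ract (unit_vec i) (f b))).1; last by rewrite g'_ract.
  congr (g' _).1; apply/ffunP => k; rewrite !ffunE.
  case: eqP => _; first exact: (etrans (mulr1 _) (esym (mul1r _))).
  by rewrite scaler0 ract0.
set t := pure _ _.
transitivity (g' (s t)).1; first by rewrite gK.
have st : s t = \sum_i ract (unit_vec i) (s t i : A).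
  apply/ffunP => k; rewrite sum_ffunE (bigD1 k) //= big1 => [|i ik].
    by rewrite addr0 !ffunE eqxx; exact: (esym (mul1r _)).
  by rewrite !ffunE eq_sym (negbTE ik) ract0.
rewrite {1}st (morph_add_sum (g := fun u => (g' u).1)) => [|u v].
  2: by rewrite g'D.
by apply: eq_bigr => i _; rewrite g'_ract.
Qed.

(** The splitting sends x (x) y to the tuple of the beta_i(x) y, and the
retraction sends a tuple u to sum_i t_i u_i. *)
Lemma quasi_basis_left_D2 n (beta : 'I_n -> S) (t : 'I_n -> AA) :
  (0 < n)%N -> quasi_basis beta t -> left_D2 f.
Proof.
move=> n_gt0 qb; exists n; split=> //.
pose coord (x : AA) : {ffun 'I_n -> BA} :=
  [ffun i => contract (endo_of_bimod_end (beta i)) x : BA].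
have coordL : linear coord.
  move=> b x y; apply/ffunP => i; rewrite !ffunE contractD.
  by rewrite contract_bimod_end_scale.
pose comb (u : {ffun 'I_n -> BA}) : AA := \sum_i ract (t i) (u i : A).
have combL : linear comb.
  move=> b u v; rewrite /comb scaler_sumr -big_split /=; apply: eq_bigr => i _.
  by rewrite !ffunE ractDr -ractZ (proj1 qb) -ractM.
apply: (@split_epi_direct_summand _ _ _ _ (linear_pack combL) _
  (linear_pack coordL)).
- move=> u a /=; rewrite /comb.
  rewrite (morph_add_sum (fun x y => ractDl x y a)); apply: eq_bigr => i _.
  by rewrite ffunE ractM.
- by move=> x a; apply/ffunP => i; rewrite /= !ffunE contract_ract.
- apply: (tensor_lift_uniq (g := fun x : AA => comb (coord x)) (h := id))
    => [x y|x y|x y] //.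
    have -> : coord (x + y) = coord x + coord y.
      exact: (linearD (linear_pack coordL)).
    exact: (linearD (linear_pack combL)).
  rewrite [RHS](quasi_basis_pure qb) /comb; apply: eq_bigr => i _.
  by rewrite ffunE contractE.
Qed.

(** * The dual basis of S and the inverse of j given by a quasi-basis *)

Section FromQuasiBasis.
Variables (n : nat) (beta : 'I_n -> S) (t : 'I_n -> AA).
Hypothesis qb : quasi_basis beta t.

(** This is the quasi-basis equation contracted along e; it is the source of
both the dual basis of S and the inverse of j. *)
Lemma quasi_basis_expand (e : E) (x : A) :
  e x = \sum_i contract e (t i) * beta i x :> A.
Proof.
transitivity (contract e (pure (x : A_B) (1 : BA))).
  by rewrite contractE mulr1.
rewrite (proj2 qb) (morph_add_sum (@contractD e)).
by apply: eq_bigr => i _; rewrite contract_ract.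
Qed.

(** Contraction along alpha in S is a B-B-bimodule map, so it sends B-central
tensors into the centralizer. *)
Lemma contract_centralizer (alpha : S) i :
  contract (endo_of_bimod_end alpha) (t i) \in centralizer_pred f.
Proof.
apply/asboolP => b.
by rewrite -contract_bimod_end_scale (proj1 qb) contract_ract.
Qed.

Definition contract_coef i (alpha : S) : R :=
  Centralizer (contract_centralizer alpha i).

Lemma contract_coef_scalar i : scalar (contract_coef i).
Proof.
move=> r alpha alpha'; apply: val_inj => /=.
rewrite (@contract_add (endo_of_bimod_end (r *: alpha))
  (endo_of_bimod_end alpha')) //.
by rewrite (@contract_scale (cval r) (endo_of_bimod_end alpha)).
Qed.

Lemma quasi_basis_dual_basis :
  dual_basis beta (fun i => scalar_pack (contract_coef_scalar i)).
Proof.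
move=> alpha; apply/val_inj/funext => x.
rewrite [RHS]bimod_end_sum.
exact: quasi_basis_expand (endo_of_bimod_end alpha) x.
Qed.

(** The inverse sends e to sum_i (e contracted with t_i) (x) beta_i. On
a (x) alpha the coefficients become a times the coordinates of alpha, which lie
in R and can be moved across the tensor sign. *)
Lemma quasi_basis_j_bijective : bijective (j (f := f)).
Proof.
pose inv (e : E) : tensor A_R S :=
  \sum_i pure (contract e (t i) : A_R) (beta i).
have [Dl _ bal] := pure_balanced A_R S.
exists inv => [u|e].
  apply: (tensor_lift_uniq (g := fun u => inv (j u)) (h := id))
    => {u} [u v||a alpha] //.
    rewrite /inv -big_split; apply: eq_bigr => i _ /=.
    rewrite -Dl; congr pure; apply: contract_add => x /=.
    by rewrite jfunD.
  rewrite {2}(quasi_basis_dual_basis alpha) pure_sumr; apply: eq_bigr => i _.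
  rewrite -bal; congr pure.
  by apply: (@contract_scale a (endo_of_bimod_end alpha)) => x; exact: jfunE.
apply: linear_ext => x.
rewrite [LHS](morph_add_sum (g := fun u => jfun u x)) => [|u v].
  2: by rewrite jfunD.
rewrite [RHS]quasi_basis_expand; apply: eq_bigr => i _; exact: jfunE.
Qed.

End FromQuasiBasis.

(** * A quasi-basis from dual bases of S and A *)

Section FromDualBases.
Variables (n : nat) (beta : 'I_n -> S) (rho : 'I_n -> {scalar S}).
Hypothesis beta_rho : dual_basis beta rho.
Variables (m : nat) (a : 'I_m -> A_B) (psi : 'I_m -> {scalar A_B}).
Hypothesis a_psi : dual_basis a psi.
Hypothesis j_bij : bijective (j (f := f)).

(** The coordinate pi_i of the endomorphism j(u) of A_B along beta_i. It is
defined on A (x)_R S, where it is induced by rho_i, and becomes a function of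
the endomorphism because j is injective. *)
Definition j_coef i (u : tensor A_R S) : A :=
  tensor_lift (fun (x : A_R) (alpha : S) => (x : A) * cval (rho i alpha)) u.

Lemma j_coef_balanced i :
  balanced (fun (x : A_R) (alpha : S) => (x : A) * cval (rho i alpha)).
Proof.
split=> [x x' alpha|x alpha alpha'|r x alpha].
- exact: mulrDl.
- by rewrite linearD /= mulrDr.
- by rewrite linearZ; exact: esym (mulrA _ _ _).
Qed.

Lemma j_coefE i (x : A) alpha :
  j_coef i (pure (x : A_R) alpha) = x * cval (rho i alpha).
Proof. exact: (tensor_liftE (j_coef_balanced i)). Qed.

Lemma j_coefD i : {morph j_coef i : u v / u + v}.
Proof. exact: (tensor_liftD (j_coef_balanced i)). Qed.

Lemma j_coef_expand u (x : A) : jfun u x = \sum_i j_coef i u * beta i x :> A.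
Proof.
apply: (tensor_lift_uniq (g := fun u => jfun u x : A)
  (h := fun u => \sum_i j_coef i u * beta i x)) => [v w|v w|y alpha].
- by rewrite jfunD.
- by rewrite -big_split; apply: eq_bigr => i _; rewrite j_coefD mulrDl.
- rewrite jfunE {1}(beta_rho alpha) bimod_end_sum mulr_sumr.
  by apply: eq_bigr => i _; rewrite j_coefE mulrA.
Qed.

Lemma right_mul_linear b : linear (fun x : A_R => ((x : A) * f b : A_R)).
Proof.
move=> r x y; rewrite [LHS]mulrDl; congr (_ + _).
by rewrite -[LHS]mulrA -centralizerP; exact: mulrA.
Qed.

(** The left A-action and the right B-action on A (x)_R S. The right B-action
multiplies the left tensor factor, which is allowed as elements of R commute
with the image of B; under j it becomes precomposition with left
multiplication. *)
Definition tensor_lmul (c : A) : tensor A_R S -> tensor A_R S :=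
  tensor_mapl (linear_pack (@left_mul_linear _ _ (@cval A B f) c)).
Definition tensor_rmul (b : B) : tensor A_R S -> tensor A_R S :=
  tensor_mapl (linear_pack (right_mul_linear b)).

Lemma jfun_tensor_lmul c u (x : A) :
  jfun (tensor_lmul c u) x = c * (jfun u x : A).
Proof.
apply: (tensor_lift_uniq (g := fun u => jfun (tensor_lmul c u) x : A)
  (h := fun u => c * (jfun u x : A))) => [v w|v w|y alpha].
- by rewrite /tensor_lmul tensor_maplD jfunD.
- by rewrite jfunD [LHS]mulrDr.
- by rewrite /tensor_lmul tensor_maplE !jfunE mulrA.
Qed.

Lemma jfun_tensor_rmul b u (x : A) :
  jfun (tensor_rmul b u) x = jfun u (f b * x).
Proof.
apply: (tensor_lift_uniq (g := fun u => jfun (tensor_rmul b u) x : A)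
  (h := fun u => jfun u (f b * x) : A)) => [v w|v w|y alpha].
- by rewrite /tensor_rmul tensor_maplD jfunD.
- by rewrite jfunD.
- by rewrite /tensor_rmul tensor_maplE !jfunE bimod_end_left mulrA.
Qed.

Lemma j_coef_tensor_lmul i c u : j_coef i (tensor_lmul c u) = c * j_coef i u.
Proof.
apply: (tensor_lift_uniq (g := fun u => j_coef i (tensor_lmul c u))
  (h := fun u => c * j_coef i u)) => [v w|v w|y alpha].
- by rewrite /tensor_lmul tensor_maplD j_coefD.
- by rewrite j_coefD mulrDr.
- by rewrite /tensor_lmul tensor_maplE !j_coefE mulrA.
Qed.

Lemma j_coef_tensor_rmul i b u : j_coef i (tensor_rmul b u) = j_coef i u * f b.
Proof.
apply: (tensor_lift_uniq (g := fun u => j_coef i (tensor_rmul b u))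
  (h := fun u => j_coef i u * f b)) => [v w|v w|y alpha].
- by rewrite /tensor_rmul tensor_maplD j_coefD.
- by rewrite j_coefD mulrDl.
- by rewrite /tensor_rmul tensor_maplE !j_coefE -!mulrA centralizerP.
Qed.

(** The identity b t_i = t_i b holds because, with e_k = f o psi_k, expanding
b a_k along the dual basis turns b t_i into
sum_l a_l (x) pi_i(sum_k e_l(b a_k) e_k), and
sum_k e_l(b a_k) e_k(x) = e_l(b x).
Injectivity of j lifts this last equation to A (x)_R S. *)
Lemma dual_bases_quasi_basis : exists t, quasi_basis beta t.
Proof.
have [jinv jK jinvK] := j_bij.
have psiL k : linear (fun x : A_B => (f (psi k x) : A_B)).
  move=> b x y; rewrite linearP rmorphD; congr (_ + _).
  exact: rmorphM.
pose T k := jinv (linear_pack (psiL k)).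
have jT k (x : A) : jfun (T k) x = f (psi k x).
  by rewrite -[LHS]/(j (T k) x) jinvK.
have dualE (x : A) : x = \sum_k (a k : A) * f (psi k x) by exact: a_psi.
have Tb l b :
    \sum_k tensor_lmul (f (psi l (f b * (a k : A)))) (T k) =
    tensor_rmul b (T l).
  apply: (can_inj jK); apply: linear_ext => x.
  rewrite [LHS](morph_add_sum (g := fun u => jfun u x)) => [|u v].
    2: by rewrite jfunD.
  rewrite [RHS]jfun_tensor_rmul jT {2}[x]dualE mulr_sumr linear_sum rmorph_sum.
  apply: eq_bigr => k _ /=; rewrite jfun_tensor_lmul jT.
  by rewrite mulrA -rmorphM; congr (f _); exact: esym (linearZ_LR _ _ _).
have [Dl Dr bal] := pure_balanced A_B BA.
exists (fun i => \sum_k pure (a k) (j_coef i (T k) : BA)); split=> [i b|x].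
  rewrite (morph_add_sum (fun x y => ractDl x y (f b))) scaler_sumr.
  transitivity (\sum_k \sum_l
      pure (a l) (f (psi l (f b * (a k : A))) * j_coef i (T k) : BA)).
    apply: eq_bigr => k _; rewrite [LHS]tsquare_scaleE.
    rewrite {1}[f b * _]dualE pure_suml; apply: eq_bigr => l _.
    exact: (bal (psi l (f b * (a k : A)))).
  rewrite exchange_big; apply: eq_bigr => l _ /=.
  rewrite [RHS]tsquare_ractE -pure_sumr -j_coef_tensor_rmul -Tb; congr pure.
  rewrite (morph_add_sum (@j_coefD i)).
  by apply: eq_bigr => k _; rewrite j_coef_tensor_lmul.
rewrite {1}[x]dualE pure_suml.
transitivity (\sum_k \sum_i pure (a k) (j_coef i (T k) * beta i x : BA)).
  apply: eq_bigr => k _; rewrite -pure_sumr -[\sum_i _]j_coef_expand jT.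
  have := bal (psi k x) (a k) (1 : BA); rewrite [_ *: (1 : BA)]mulr1; exact.
rewrite exchange_big; apply: eq_bigr => i _ /=.
rewrite (morph_add_sum (fun u v => ractDl u v (beta i x))).
by apply: eq_bigr => k _; rewrite [RHS]tsquare_ractE.
Qed.

End FromDualBases.

(** * Balancedness and invariants *)

Lemma base_invariant b : Defs.invariant f (f b).
Proof. by move=> alpha; rewrite -{1}[f b]mul1r bimod_end_right. Qed.

(** For an invariant x and e in E, the map z |-> e(y z) is again in E, hence of
the form sum_k a_k alpha_k; its value at x is its value at 1 times x. So right
multiplication by x is E-linear. *)
Lemma balanced_invariants_eq_base :
  bijective (j (f := f)) -> balanced_module f -> invariants_eq_base f.
Proof.
move=> [jinv _ jinvK] bal x; split=> [x_inv|[b ->]]; last exact: base_invariant.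
pose rx : {additive A -> A} := x \o* idfun.
have [e y|b rxE] := bal rx; last first.
  by exists b; rewrite -[x]mul1r -[f b]mul1r -rxE.
have eyL : linear (fun z : A_B => e (y * (z : A) : A)).
  by move=> b z w; rewrite -linearP; congr (e _); rewrite mulrDr mulrA.
pose u := jinv (linear_pack eyL).
have uE (z : A) : e (y * z : A) = jfun u z.
  by rewrite -[RHS]/(j u z) jinvK.
rewrite /= uE -[y in e y]mulr1 uE /jfun /tensor_lift !fct_sumE mulr_suml.
by apply: eq_bigr => p _; rewrite x_inv mulrA.
Qed.

(** E contains the left multiplications, so an E-linear phi is right
multiplication by phi(1); E also contains S, so phi(1) is invariant. *)
Lemma invariants_eq_base_balanced :
  invariants_eq_base f -> balanced_module f.
Proof.
move=> invB phi phiE.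
have phi1 (x : A) : phi x = x * phi 1.
  by rewrite -[in LHS](mulr1 x) (phiE (linear_pack (@left_mul_linear _ _ f x))).
have [|b phi1E] := (invB (phi 1)).1.
  move=> alpha; rewrite -phi1.
  exact: esym (phiE (endo_of_bimod_end alpha) 1).
by exists b => x; rewrite phi1 phi1E.
Qed.

End QuasiBasis.

(** * The Galois criterion *)

Theorem theorem4p2 (K : comPzRingType) (A B : pzRingType)
    (etaA : {rmorphism K -> A}) (etaB : {rmorphism K -> B})
    (algA : algebra_structure etaA) (algB : algebra_structure etaB)
    (f : {rmorphism B -> A}) (f_alg : forall k : K, f (etaB k) = etaA k)
    (fgpA : fg_projective (rmod_of f : lmodType B^c)) :
  left_Galois f <->
  [/\ fg_projective (bimod_end f : lmodType (centralizer f)),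
      bijective (j (f := f)) &
      invariants_eq_base f].
Proof.
split=> [[D2 bal]|[fgpS j_bij invB]].
  have [n [beta [t qb]]] := left_D2_quasi_basis D2.
  have j_bij := quasi_basis_j_bijective qb.
  split=> //; last exact: balanced_invariants_eq_base.
  exact: dual_basis_fg_projective (quasi_basis_dual_basis qb).
split; last exact: invariants_eq_base_balanced.
have [n [beta [rho beta_rho]]] := fg_projective_dual_basis fgpS.
have [m [a [psi a_psi]]] := fg_projective_dual_basis fgpA.
have [t qb] := dual_bases_quasi_basis beta_rho a_psi j_bij.
exact: quasi_basis_left_D2 qb.
Qed.
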